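(* (Type Preservation.) Let $M$ be a closed choreography of Chor$\lambda$ and $D$ a set of definitions. If there exists a typing context $\Theta;\Sigma;\Gamma$ such that $\Theta;\Sigma;\Gamma\vdash M:T$ and $\Theta;\Sigma;\Gamma\vdash D$, then $\Theta;\Sigma;\Gamma\vdash M':T$ for any $M'$ such that $M\to_D M'$.
   Context: **Syntax of Chor$\lambda$.** There are variables $x$, labels $l$, choreography (function) names $f$, roles $R,S$, and type variables $t$; $\rho$ ranges over finite sets of roles, $\vec R$ over lists of roles. Choreographies $M$, values $V$, types $T$: - $M ::= V \mid f(\vec R)\mid M\,M\mid \mathsf{case}\ M\ \mathsf{of}\ \mathsf{Inl}\,x\Rightarrow M;\ \mathsf{Inr}\,x\Rightarrow M\mid \mathsf{select}_{R,R}\,l\,M$ - $V ::= x\mid \lambda x{:}T.M\mid \mathsf{Inl}\,V\mid\mathsf{Inr}\,V\mid\mathsf{fst}\mid\mathsf{snd}\mid\mathsf{Pair}\,V\,V\mid ()@R\mid \mathsf{com}_{R,R}$ - $T ::= T\to_\rho T\mid T+T\mid T\times T\mid ()@R\mid t@\vec R$ $\lambda x{:}T.M$ binds $x$ in $M$; $\mathsf{case}\ N\ \mathsf{of}\ \mathsf{Inl}\,x\Rightarrow M;\ \mathsf{Inr}\,x'\Rightarrow M'$ binds $x$ in $M$ and $x'$ in $M'$; terms are taken up to renaming of bound variables. $\mathrm{fv}(M)$ is the set of free variables; $M$ is closed if $\mathrm{fv}(M)=\emptyset$. $[x:=V]$ is capture-avoiding substitution; $[S:=R]$ and $[\vec R':=\vec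 R]$ are (simultaneous) replacement of roles. $\mathrm{roles}(t@\vec R)=\vec R$, $\mathrm{roles}(()@R)=\{R\}$, $\mathrm{roles}(T\to_\rho T')=\mathrm{roles}(T)\cup\mathrm{roles}(T')\cup\rho$, $\mathrm{roles}(T+T')=\mathrm{roles}(T\times T')=\mathrm{roles}(T)\cup\mathrm{roles}(T')$. $\mathrm{roles}(M)$ is the set of roles occurring in $M$. Synchronising roles: $\mathrm{sroles}(\mathsf{com}_{S,R})=\{S,R\}$, $\mathrm{sroles}(\mathsf{select}_{S,R}\,l\,M)=\{S,R\}\cup\mathrm{sroles}(M)$, $\mathrm{sroles}(f(\vec R))=\vec R$, and in all other cases the union over the immediate subterms. A set of definitions $D$ maps expressions $f(\vec R)$ ($\vec R$ the role parameters) to choreographies $D(f(\vec R))$. **Typing.** In $\Theta;\Sigma;\Gamma\vdash M:T$: $\Theta$ is a set of roles; $\Sigma$ is a set of type definitions $t@\vec R=T$ with $\vec R$ distinct, each $t$ defined at most once, definitions contractive, and $\mathrm{roles}(T)=\vec R$; $\Gamma$ contains assignments $x:T$ and $f(\vec R):T$, each name occurring at most once. $\mathrm{dist}(\vec R)$ means the elements of $\vec R$ are distinct, $\|\vec R\|$ is the length. Rules: - TVar: $\Theta;\Sigma;\Gamma\vdash x:T$ if $x:T\in\Gamma$ and $\mathrm{roles}(T)\subseteq\Theta$. - TApp: $\Theta;\Sigma;\Gamma\vdash N\,M:T'$ if $\Theta;\Sigma;\Gamma\vdash N:T\to_\rho T'$ and $\Theta;\Sigma;\Gamma\vdash M:T$.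 - TAbs: $\Theta;\Sigma;\Gamma\vdash\lambda x{:}T.M:T\to_\rho T'$ if $\Theta';\Sigma;\Gamma,x:T\vdash M:T'$ with $\Theta'=\rho\cup\mathrm{roles}(T)\cup\mathrm{roles}(T')\subseteq\Theta$. - TCase: $\Theta;\Sigma;\Gamma\vdash\mathsf{case}\ N\ \mathsf{of}\ \mathsf{Inl}\,x\Rightarrow M';\ \mathsf{Inr}\,x'\Rightarrow M'':T$ if $\Theta;\Sigma;\Gamma\vdash N:T_1+T_2$, $\Theta;\Sigma;\Gamma,x:T_1\vdash M':T$, $\Theta;\Sigma;\Gamma,x':T_2\vdash M'':T$. - TSel: $\Theta;\Sigma;\Gamma\vdash\mathsf{select}_{S,R}\,l\,M:T$ if $\Theta;\Sigma;\Gamma\vdash M:T$ and $\{S,R\}\subseteq\Theta$. - TDef: $\Theta;\Sigma;\Gamma\vdash f(\vec R):T[\vec R':=\vec R]$ if $f(\vec R'):T\in\Gamma$, $\mathrm{roles}(T)\subseteq\vec R'$, $\vec R\subseteq\Theta$, $\|\vec R\|=\|\vec R'\|$, $\mathrm{dist}(\vec R)$. - TUnit: $\Theta;\Sigma;\Gamma\vdash ()@R:()@R$ if $R\in\Theta$. - TCom: $\Theta;\Sigma;\Gamma\vdash\mathsf{com}_{S,R}:T\to_\emptyset T[S:=R]$ if $\mathrm{roles}(T)=\{S\}$ and $\{S,R\}\subseteq\Theta$. - TPair: $\Theta;\Sigma;\Gamma\vdash\mathsf{Pair}\,V\,V':T\times T'$ if $\Theta;\Sigma;\Gamma\vdash V:T$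 and $\Theta;\Sigma;\Gamma\vdash V':T'$. - TProj1/2: $\Theta;\Sigma;\Gamma\vdash\mathsf{fst}:(T\times T')\to_\emptyset T$ and $\Theta;\Sigma;\Gamma\vdash\mathsf{snd}:(T\times T')\to_\emptyset T'$ if $\mathrm{roles}(T\times T')\subseteq\Theta$. - TInl/TInr: $\Theta;\Sigma;\Gamma\vdash\mathsf{Inl}\,V:T+T'$ if $\Theta;\Sigma;\Gamma\vdash V:T$ (resp. $\mathsf{Inr}\,V:T+T'$ if $V:T'$) and $\mathrm{roles}(T+T')\subseteq\Theta$. - TEq: $\Theta;\Sigma;\Gamma\vdash M:T[\vec R:=\vec R']$ if $\Theta;\Sigma;\Gamma\vdash M:t@\vec R'$, $t@\vec R=T$ is in $\Sigma$, $\vec R'\subseteq\Theta$, $\|\vec R\|=\|\vec R'\|$, $\mathrm{dist}(\vec R')$. $\Theta;\Sigma;\Gamma\vdash D$ holds if for every $f(\vec R)\in\mathrm{domain}(D)$ there is $T$ with $f(\vec R):T\in\Gamma$, $\vec R;\Sigma;\Gamma\vdash D(f(\vec R)):T$, $\mathrm{dist}(\vec R)$, and $\vec R\subseteq\Theta$. **Rewriting** $\rightsquigarrow$ is given by: - R-AbsR: $((\lambda x{:}T.M)\,N)\,M'\rightsquigarrow(\lambda x{:}T.(M\,M'))\,N$ if $x\notin\mathrm{fv}(M')$. - R-AbsL: $M'\,((\lambda x{:}T.M)\,N)\rightsquigarrow(\lambda x{:}T.(M'\,M))\,N$ if $x\notin\mathrm{fv}(M')$ and $\mathrm{sroles}(M')\cap\mathrm{roles}(N)=\emptyset$.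 - R-CaseR: $(\mathsf{case}\ N\ \mathsf{of}\ \mathsf{Inl}\,x\Rightarrow M_1;\mathsf{Inr}\,x'\Rightarrow M_2)\,M\rightsquigarrow\mathsf{case}\ N\ \mathsf{of}\ \mathsf{Inl}\,x\Rightarrow (M_1\,M);\mathsf{Inr}\,x'\Rightarrow (M_2\,M)$ if $x,x'\notin\mathrm{fv}(M)$. - R-CaseL: $M\,(\mathsf{case}\ N\ \mathsf{of}\ \mathsf{Inl}\,x\Rightarrow M_1;\mathsf{Inr}\,x'\Rightarrow M_2)\rightsquigarrow\mathsf{case}\ N\ \mathsf{of}\ \mathsf{Inl}\,x\Rightarrow (M\,M_1);\mathsf{Inr}\,x'\Rightarrow (M\,M_2)$ if $x,x'\notin\mathrm{fv}(M)$ and $\mathrm{sroles}(M)\cap\mathrm{roles}(N)=\emptyset$. - R-SelR: $(\mathsf{select}_{S,R}\,l\,N)\,M\rightsquigarrow\mathsf{select}_{S,R}\,l\,(N\,M)$. - R-SelL: $M\,(\mathsf{select}_{S,R}\,l\,N)\rightsquigarrow\mathsf{select}_{S,R}\,l\,(M\,N)$ if $\mathrm{sroles}(M)\cap\mathrm{roles}(N)=\emptyset$. **Semantics.** Transitions $M\xrightarrow{\ell,\mathbf R}_D M'$ with $\ell\in\{\tau,\lambda\}$ and $\mathbf R$ a set of roles: - AppAbs: $(\lambda x{:}T.M)\,V\xrightarrow{\tau,\emptyset}_D M[x:=V]$. - InAbs: $\lambda x{:}T.M\xrightarrow{\lambda,\mathbf R}_D\lambda x{:}T.M'$ if $M\xrightarrow{\ell,\mathbf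 R}_D M'$. - App1: $M\,N\xrightarrow{\tau,\mathbf R}_D M'\,N$ if $M\xrightarrow{\ell,\mathbf R}_D M'$ and ($\ell=\lambda$ implies $\mathbf R\cap\mathrm{roles}(N)=\emptyset$). - App2: $V\,N\xrightarrow{\tau,\mathbf R}_D V\,N'$ if $N\xrightarrow{\tau,\mathbf R}_D N'$. - App3: $M\,N\xrightarrow{\tau,\mathbf R}_D M\,N'$ if $N\xrightarrow{\tau,\mathbf R}_D N'$ and $\mathbf R\cap\mathrm{roles}(M)=\emptyset$. - Case: $\mathsf{case}\ N\ \mathsf{of}\ \mathsf{Inl}\,x\Rightarrow M;\mathsf{Inr}\,x'\Rightarrow M'\xrightarrow{\tau,\mathbf R}_D\mathsf{case}\ N'\ \mathsf{of}\ \mathsf{Inl}\,x\Rightarrow M;\mathsf{Inr}\,x'\Rightarrow M'$ if $N\xrightarrow{\tau,\mathbf R}_D N'$. - InCase: $\mathsf{case}\ N\ \mathsf{of}\ \mathsf{Inl}\,x\Rightarrow M_1;\mathsf{Inr}\,x'\Rightarrow M_2\xrightarrow{\ell,\mathbf R}_D\mathsf{case}\ N\ \mathsf{of}\ \mathsf{Inl}\,x\Rightarrow M_1';\mathsf{Inr}\,x'\Rightarrow M_2'$ if $M_1\xrightarrow{\ell,\mathbf R}_D M_1'$, $M_2\xrightarrow{\ell,\mathbf R}_D M_2'$, $\mathbf R\cap\mathrm{roles}(N)=\emptyset$. - CaseL/CaseR: $\mathsf{case}\ \mathsf{Inl}\,V\ \mathsf{of}\ \mathsf{Inl}\,x\Rightarrow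 M;\mathsf{Inr}\,x'\Rightarrow M'\xrightarrow{\tau,\emptyset}_D M[x:=V]$; the same with $\mathsf{Inr}\,V$ as scrutinee steps to $M'[x':=V]$. - Proj1/Proj2: $\mathsf{fst}\,(\mathsf{Pair}\,V\,V')\xrightarrow{\tau,\emptyset}_D V$; $\mathsf{snd}\,(\mathsf{Pair}\,V\,V')\xrightarrow{\tau,\emptyset}_D V'$. - Def: $f(\vec R)\xrightarrow{\tau,\emptyset}_D M[\vec R':=\vec R]$ if $D(f(\vec R'))=M$. - Com: $\mathsf{com}_{S,R}\,V\xrightarrow{\tau,\{S,R\}}_D V[S:=R]$ if $\mathrm{fv}(V)=\emptyset$. - Sel: $\mathsf{select}_{S,R}\,l\,M\xrightarrow{\tau,\{S,R\}}_D M$. - InSel: $\mathsf{select}_{S,R}\,l\,M\xrightarrow{\ell,\mathbf R}_D\mathsf{select}_{S,R}\,l\,M'$ if $M\xrightarrow{\ell,\mathbf R}_D M'$ and $\mathbf R\cap\{S,R\}=\emptyset$. - Str: $M\xrightarrow{\tau,\mathbf R}_D M'$ if $M\rightsquigarrow^* N$ and $N\xrightarrow{\tau,\mathbf R}_D M'$. $M\to_D M'$ means $M\xrightarrow{\tau,\mathbf R}_D M'$ for some $\mathbf R$.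
   Formalization: The formal theorem also assumes that every body D(f(R)) has no free variables; without this the claim fails: with x:()@0 and f(0):()@0 in Γ and D(f(0)) = x, the closed f(1):()@1 steps to x, which has type ()@0 only. *)

(* Defs.v *)
From mathcomp Require Import all_boot finmap.
From Stdlib Require Import Relation_Operators.

Set Implicit Arguments.
Unset Strict Implicit.
Unset Printing Implicit Defensive.

Local Open Scope fset_scope.

(* Each syntactic class of atomic names is a copy of the natural numbers. *)
Definition role := nat.
Definition lab := nat.
Definition fname := nat.
Definition tvar := nat.

Definition rset (Rs : seq role) : {fset role} := [fset X in Rs].

(* The simultaneous replacement [Rs' := Rs]; [S := R] is the case of
   singleton lists.  It is only meaningful on lists of equal length. *)
Definition rrepl (Rs' Rs : seq role) (X : role) : role :=
  if X \in Rs' then nth X Rs (index X Rs') else X.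

Inductive ty : Type :=
| TyArr of ty & {fset role} & ty
| TySum of ty & ty
| TyProd of ty & ty
| TyUnit of role
| TyVar of tvar & seq role.

Fixpoint ty_roles (T : ty) : {fset role} :=
  match T with
  | TyArr T1 rho T2 => ty_roles T1 `|` ty_roles T2 `|` rho
  | TySum T1 T2 | TyProd T1 T2 => ty_roles T1 `|` ty_roles T2
  | TyUnit R => [fset R]
  | TyVar _ Rs => rset Rs
  end.

Fixpoint ty_map (phi : role -> role) (T : ty) : ty :=
  match T with
  | TyArr T1 rho T2 =>
      TyArr (ty_map phi T1) [fset phi X | X in rho] (ty_map phi T2)
  | TySum T1 T2 => TySum (ty_map phi T1) (ty_map phi T2)
  | TyProd T1 T2 => TyProd (ty_map phi T1) (ty_map phi T2)
  | TyUnit R => TyUnit (phi R)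
  | TyVar t Rs => TyVar t (map phi Rs)
  end.

(* Terms modulo renaming of bound variables, in de Bruijn notation: [Var n] is
   the variable bound by the n-th enclosing binder, or, beyond all the binders,
   an entry of the typing context.  [Lam T M] binds one variable in [M], and
   [Case N M1 M2] binds one variable in [M1] and one in [M2]. *)
Inductive chor : Type :=
| Val of value
| Fun of fname & seq role
| App of chor & chor
| Case of chor & chor & chor
| Sel of role & role & lab & chor
with value : Type :=
| Var of nat
| Lam of ty & chor
| Inl of value
| Inr of value
| Fst
| Snd
| Pair of value & value
| Unit of role
| Com of role & role.

Fixpoint roles (M : chor) : {fset role} :=
  match M with
  | Val V => val_roles V
  | Fun _ Rs => rset Rs
  | App M1 M2 => roles M1 `|` roles M2
  | Case N M1 M2 => roles N `|` roles M1 `|` roles M2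
  | Sel R1 R2 _ M1 => [fset R1; R2] `|` roles M1
  end
with val_roles (V : value) : {fset role} :=
  match V with
  | Lam T M => ty_roles T `|` roles M
  | Inl V1 | Inr V1 => val_roles V1
  | Pair V1 V2 => val_roles V1 `|` val_roles V2
  | Unit R => [fset R]
  | Com R1 R2 => [fset R1; R2]
  | Var _ | Fst | Snd => fset0
  end.

Fixpoint sroles (M : chor) : {fset role} :=
  match M with
  | Val V => val_sroles V
  | Fun _ Rs => rset Rs
  | App M1 M2 => sroles M1 `|` sroles M2
  | Case N M1 M2 => sroles N `|` sroles M1 `|` sroles M2
  | Sel R1 R2 _ M1 => [fset R1; R2] `|` sroles M1
  end
with val_sroles (V : value) : {fset role} :=
  match V with
  | Lam _ M => sroles M
  | Inl V1 | Inr V1 => val_sroles V1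
  | Pair V1 V2 => val_sroles V1 `|` val_sroles V2
  | Com R1 R2 => [fset R1; R2]
  | Var _ | Fst | Snd | Unit _ => fset0
  end.

(* Removing the innermost bound variable from a set of free variables. *)
Definition unbind (A : {fset nat}) : {fset nat} := [fset n.-1 | n in A `\ 0].

Fixpoint fv (M : chor) : {fset nat} :=
  match M with
  | Val V => val_fv V
  | Fun _ _ => fset0
  | App M1 M2 => fv M1 `|` fv M2
  | Case N M1 M2 => fv N `|` unbind (fv M1) `|` unbind (fv M2)
  | Sel _ _ _ M1 => fv M1
  end
with val_fv (V : value) : {fset nat} :=
  match V with
  | Var n => [fset n]
  | Lam _ M => unbind (fv M)
  | Inl V1 | Inr V1 => val_fv V1
  | Pair V1 V2 => val_fv V1 `|` val_fv V2
  | Fst | Snd | Unit _ | Com _ _ => fset0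
  end.

Definition is_closed (M : chor) : Prop := fv M = fset0.

Fixpoint rmap (phi : role -> role) (M : chor) : chor :=
  match M with
  | Val V => Val (val_rmap phi V)
  | Fun f Rs => Fun f (map phi Rs)
  | App M1 M2 => App (rmap phi M1) (rmap phi M2)
  | Case N M1 M2 => Case (rmap phi N) (rmap phi M1) (rmap phi M2)
  | Sel R1 R2 l M1 => Sel (phi R1) (phi R2) l (rmap phi M1)
  end
with val_rmap (phi : role -> role) (V : value) : value :=
  match V with
  | Var n => Var n
  | Lam T M => Lam (ty_map phi T) (rmap phi M)
  | Inl V1 => Inl (val_rmap phi V1)
  | Inr V1 => Inr (val_rmap phi V1)
  | Fst => Fst
  | Snd => Snd
  | Pair V1 V2 => Pair (val_rmap phi V1) (val_rmap phi V2)
  | Unit R => Unit (phi R)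
  | Com R1 R2 => Com (phi R1) (phi R2)
  end.

Definition up_ren (xi : nat -> nat) (n : nat) : nat :=
  if n is n'.+1 then (xi n').+1 else 0.

Fixpoint ren (xi : nat -> nat) (M : chor) : chor :=
  match M with
  | Val V => Val (val_ren xi V)
  | Fun f Rs => Fun f Rs
  | App M1 M2 => App (ren xi M1) (ren xi M2)
  | Case N M1 M2 => Case (ren xi N) (ren (up_ren xi) M1) (ren (up_ren xi) M2)
  | Sel R1 R2 l M1 => Sel R1 R2 l (ren xi M1)
  end
with val_ren (xi : nat -> nat) (V : value) : value :=
  match V with
  | Var n => Var (xi n)
  | Lam T M => Lam T (ren (up_ren xi) M)
  | Inl V1 => Inl (val_ren xi V1)
  | Inr V1 => Inr (val_ren xi V1)
  | Fst => Fst
  | Snd => Snd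
  | Pair V1 V2 => Pair (val_ren xi V1) (val_ren xi V2)
  | Unit R => Unit R
  | Com R1 R2 => Com R1 R2
  end.

Definition shift (M : chor) : chor := ren succn M.

Definition up_sub (sigma : nat -> value) (n : nat) : value :=
  if n is n'.+1 then val_ren succn (sigma n') else Var 0.

Fixpoint sub (sigma : nat -> value) (M : chor) : chor :=
  match M with
  | Val V => Val (val_sub sigma V)
  | Fun f Rs => Fun f Rs
  | App M1 M2 => App (sub sigma M1) (sub sigma M2)
  | Case N M1 M2 =>
      Case (sub sigma N) (sub (up_sub sigma) M1) (sub (up_sub sigma) M2)
  | Sel R1 R2 l M1 => Sel R1 R2 l (sub sigma M1)
  end
with val_sub (sigma : nat -> value) (V : value) : value :=
  match V with
  | Var n => sigma n
  | Lam T M => Lam T (sub (up_sub sigma) M)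
  | Inl V1 => Inl (val_sub sigma V1)
  | Inr V1 => Inr (val_sub sigma V1)
  | Fst => Fst
  | Snd => Snd
  | Pair V1 V2 => Pair (val_sub sigma V1) (val_sub sigma V2)
  | Unit R => Unit R
  | Com R1 R2 => Com R1 R2
  end.

(* M[x := V], where x is the variable bound around M *)
Definition sub1 (V : value) (M : chor) : chor :=
  sub (fun n => if n is n'.+1 then Var n' else V) M.

(* [Sigma t = Some (Rs, T)] stands for the type definition t@Rs = T; being a
   partial function, Sigma defines each t at most once. *)
Definition tdefs := tvar -> option (seq role * ty).

(* Contractive: unfolding type variables that stand for bare type variables
   always terminates, so every cycle of definitions goes through a type
   constructor. *)
Definition contractive (Sigma : tdefs) : Prop :=
  well_founded (fun t' t =>
    exists Rs Rs' : seq role, Sigma t = Some (Rs, TyVar t' Rs')).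

Definition wf_tdefs (Sigma : tdefs) : Prop :=
  (forall t Rs T, Sigma t = Some (Rs, T) -> uniq Rs /\ ty_roles T = rset Rs)
  /\ contractive Sigma.

(* [fdecls f = Some (Rs, T)] stands for the assignment f(Rs) : T.  The n-th
   entry of [vdecls] is the type of the free variable [Var n]. *)
Record ctx : Type := Ctx {
  fdecls : fname -> option (seq role * ty);
  vdecls : seq ty
}.

Definition bindv (Gamma : ctx) (T : ty) : ctx :=
  Ctx (fdecls Gamma) (T :: vdecls Gamma).

Inductive typing (Theta : {fset role}) (Sigma : tdefs) (Gamma : ctx) :
  chor -> ty -> Prop :=
| T_Var n T :
    onth (vdecls Gamma) n = Some T ->
    ty_roles T `<=` Theta ->
    typing Theta Sigma Gamma (Val (Var n)) T
| T_App N M T rho T' :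
    typing Theta Sigma Gamma N (TyArr T rho T') ->
    typing Theta Sigma Gamma M T ->
    typing Theta Sigma Gamma (App N M) T'
| T_Abs T M rho T' :
    let Theta' := rho `|` ty_roles T `|` ty_roles T' in
    typing Theta' Sigma (bindv Gamma T) M T' ->
    Theta' `<=` Theta ->
    typing Theta Sigma Gamma (Val (Lam T M)) (TyArr T rho T')
| T_Case N M' M'' T1 T2 T :
    typing Theta Sigma Gamma N (TySum T1 T2) ->
    typing Theta Sigma (bindv Gamma T1) M' T ->
    typing Theta Sigma (bindv Gamma T2) M'' T ->
    typing Theta Sigma Gamma (Case N M' M'') T
| T_Sel S R l M T :
    typing Theta Sigma Gamma M T ->
    [fset S; R] `<=` Theta ->
    typing Theta Sigma Gamma (Sel S R l M) T
| T_Def f Rs Rs' T :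
    fdecls Gamma f = Some (Rs', T) ->
    ty_roles T `<=` rset Rs' ->
    rset Rs `<=` Theta ->
    size Rs = size Rs' ->
    uniq Rs ->
    typing Theta Sigma Gamma (Fun f Rs) (ty_map (rrepl Rs' Rs) T)
| T_Unit R :
    R \in Theta ->
    typing Theta Sigma Gamma (Val (Unit R)) (TyUnit R)
| T_Com S R T :
    ty_roles T = [fset S] ->
    [fset S; R] `<=` Theta ->
    typing Theta Sigma Gamma (Val (Com S R))
      (TyArr T fset0 (ty_map (rrepl [:: S] [:: R]) T))
| T_Pair V V' T T' :
    typing Theta Sigma Gamma (Val V) T ->
    typing Theta Sigma Gamma (Val V') T' ->
    typing Theta Sigma Gamma (Val (Pair V V')) (TyProd T T')
| T_Proj1 T T' :
    ty_roles (TyProd T T') `<=` Theta ->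
    typing Theta Sigma Gamma (Val Fst) (TyArr (TyProd T T') fset0 T)
| T_Proj2 T T' :
    ty_roles (TyProd T T') `<=` Theta ->
    typing Theta Sigma Gamma (Val Snd) (TyArr (TyProd T T') fset0 T')
| T_Inl V T T' :
    typing Theta Sigma Gamma (Val V) T ->
    ty_roles (TySum T T') `<=` Theta ->
    typing Theta Sigma Gamma (Val (Inl V)) (TySum T T')
| T_Inr V T T' :
    typing Theta Sigma Gamma (Val V) T' ->
    ty_roles (TySum T T') `<=` Theta ->
    typing Theta Sigma Gamma (Val (Inr V)) (TySum T T')
| T_Eq M t Rs Rs' T :
    typing Theta Sigma Gamma M (TyVar t Rs') ->
    Sigma t = Some (Rs, T) ->
    rset Rs' `<=` Theta ->
    size Rs = size Rs' ->
    uniq Rs' ->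
    typing Theta Sigma Gamma M (ty_map (rrepl Rs Rs') T).

(* [D f Rs = Some M] stands for D(f(Rs)) = M. *)
Definition defs := fname -> seq role -> option chor.

(* Bodies have no free variables: a definition f(Rs) = M is parametric in the
   roles Rs only.  This convention is essential.  If the context assigns
   x : ()@R and f(R) : ()@R, then the open definition f(R) = x is well typed,
   but the closed choreography f(S) : ()@S steps to x : ()@R. *)
Definition closed_defs (D : defs) : Prop :=
  forall f Rs M, D f Rs = Some M -> is_closed M.

Definition typed_defs (Theta : {fset role}) (Sigma : tdefs) (Gamma : ctx)
    (D : defs) : Prop :=
  forall f Rs M, D f Rs = Some M ->
    exists T : ty,
      [/\ fdecls Gamma f = Some (Rs, T),
          typing (rset Rs) Sigma Gamma M T,
          uniq Rs
        & rset Rs `<=` Theta].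

(* A term moved under a binder is shifted; this makes the side conditions
   x \notin fv(M') hold by construction. *)
Inductive rew : chor -> chor -> Prop :=
| R_AbsR T M N M' :
    rew (App (App (Val (Lam T M)) N) M')
        (App (Val (Lam T (App M (shift M')))) N)
| R_AbsL T M N M' :
    [disjoint sroles M' & roles N] ->
    rew (App M' (App (Val (Lam T M)) N))
        (App (Val (Lam T (App (shift M') M))) N)
| R_CaseR N M1 M2 M :
    rew (App (Case N M1 M2) M)
        (Case N (App M1 (shift M)) (App M2 (shift M)))
| R_CaseL N M1 M2 M :
    [disjoint sroles M & roles N] ->
    rew (App M (Case N M1 M2))
        (Case N (App (shift M) M1) (App (shift M) M2))
| R_SelR S R l N M :
    rew (App (Sel S R l N) M) (Sel S R l (App N M))
| R_SelL S R l N M :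
    [disjoint sroles M & roles N] ->
    rew (App M (Sel S R l N)) (Sel S R l (App M N)).

Inductive tlabel : Type := Ltau | Llam.

(* In [S_Def] the body of f needs no shift, whatever the binders around the
   call, because bodies of definitions are closed. *)
Inductive step (D : defs) : chor -> tlabel -> {fset role} -> chor -> Prop :=
| S_AppAbs T M V :
    step D (App (Val (Lam T M)) (Val V)) Ltau fset0 (sub1 V M)
| S_InAbs T M M' ell RR :
    step D M ell RR M' ->
    step D (Val (Lam T M)) Llam RR (Val (Lam T M'))
| S_App1 M M' N ell RR :
    step D M ell RR M' ->
    (ell = Llam -> [disjoint RR & roles N]) ->
    step D (App M N) Ltau RR (App M' N)
| S_App2 V N N' RR :
    step D N Ltau RR N' ->
    step D (App (Val V) N) Ltau RR (App (Val V) N')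
| S_App3 M N N' RR :
    step D N Ltau RR N' ->
    [disjoint RR & roles M] ->
    step D (App M N) Ltau RR (App M N')
| S_Case N N' M M' RR :
    step D N Ltau RR N' ->
    step D (Case N M M') Ltau RR (Case N' M M')
| S_InCase N M1 M1' M2 M2' ell RR :
    step D M1 ell RR M1' ->
    step D M2 ell RR M2' ->
    [disjoint RR & roles N] ->
    step D (Case N M1 M2) ell RR (Case N M1' M2')
| S_CaseL V M M' :
    step D (Case (Val (Inl V)) M M') Ltau fset0 (sub1 V M)
| S_CaseR V M M' :
    step D (Case (Val (Inr V)) M M') Ltau fset0 (sub1 V M')
| S_Proj1 V V' :
    step D (App (Val Fst) (Val (Pair V V'))) Ltau fset0 (Val V)
| S_Proj2 V V' :
    step D (App (Val Snd) (Val (Pair V V'))) Ltau fset0 (Val V')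
| S_Def f Rs Rs' M :
    D f Rs' = Some M ->
    step D (Fun f Rs) Ltau fset0 (rmap (rrepl Rs' Rs) M)
| S_Com S R V :
    is_closed (Val V) ->
    step D (App (Val (Com S R)) (Val V)) Ltau [fset S; R]
      (Val (val_rmap (rrepl [:: S] [:: R]) V))
| S_Sel S R l M :
    step D (Sel S R l M) Ltau [fset S; R] M
| S_InSel S R l M M' ell RR :
    step D M ell RR M' ->
    [disjoint RR & [fset S; R]] ->
    step D (Sel S R l M) ell RR (Sel S R l M')
| S_Str M N M' RR :
    clos_refl_trans chor rew M N ->
    step D N Ltau RR M' ->
    step D M Ltau RR M'.

Definition reduces (D : defs) (M M' : chor) : Prop :=
  exists RR : {fset role}, step D M Ltau RR M'.

(* Main.v *)
Require Import Defs.
From mathcomp Require Import all_boot finmap.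
From Stdlib Require Import Relation_Operators.

Set Implicit Arguments.
Unset Strict Implicit.
Unset Printing Implicit Defensive.

Local Open Scope fset_scope.

(** Typing is preserved in every role set and every variable context, because a
    step may happen below binders.  Three facts carry the argument: a value is
    typable in just the roles of its type, so it can be substituted below an
    abstraction with a smaller role set; a closed term stays typable under a
    renaming that is injective on its role set, which covers both communication
    (the role set is a singleton) and function unfolding (the actual roles are
    distinct); and rule TEq only unfolds type variables, so it can be delayed to
    the end of a derivation.  When rewriting moves a term under an abstraction,
    the annotation rho of that abstraction is chosen to be all of Theta. *)

(** * Roles of types and replacement of roles *)

Lemma in_rset (Rs : seq role) X : (X \in rset Rs) = (X \in Rs).
Proof. by rewrite !inE. Qed.

Lemma rset_map (phi : role -> role) Rs :
  rset (map phi Rs) = [fset phi X | X in rset Rs].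
Proof.
apply/fsetP => X; rewrite in_rset; apply/mapP/imfsetP => /= -[Y inY ->];
  by exists Y => //; move: inY; rewrite in_rset.
Qed.

Lemma ty_roles_map phi T :
  ty_roles (ty_map phi T) = [fset phi X | X in ty_roles T].
Proof.
elim: T => [A IHA rho B IHB|A IHA B IHB|A IHA B IHB|R|t Rs] /=.
- by rewrite IHA IHB !imfsetU.
- by rewrite IHA IHB imfsetU.
- by rewrite IHA IHB imfsetU.
- by rewrite imfset_fset1.
- exact: rset_map.
Qed.

Lemma eq_in_imfset_id (phi psi : role -> role) (A : {fset role}) :
  {in A, phi =1 psi} -> [fset phi X | X in A] = [fset psi X | X in A].
Proof.
move=> eq_f; apply/fsetP => X; apply/imfsetP/imfsetP => /= -[Y inY ->];
  by exists Y => //; rewrite eq_f.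
Qed.

Lemma eq_in_ty_map phi psi T :
  {in ty_roles T, phi =1 psi} -> ty_map phi T = ty_map psi T.
Proof.
elim: T => [A IHA rho B IHB|A IHA B IHB|A IHA B IHB|R|t Rs] /= eq_f.
- rewrite IHA ?IHB ?(@eq_in_imfset_id phi psi) // => X inX; apply: eq_f;
    by rewrite !inE inX ?orbT.
- by rewrite IHA ?IHB // => X inX; apply: eq_f; rewrite !inE inX ?orbT.
- by rewrite IHA ?IHB // => X inX; apply: eq_f; rewrite !inE inX ?orbT.
- by rewrite eq_f // inE.
- by congr TyVar; apply/eq_in_map => X inX; apply: eq_f; rewrite in_rset.
Qed.

Lemma ty_map_comp phi psi T :
  ty_map phi (ty_map psi T) = ty_map (phi \o psi) T.
Proof.
elim: T => [A IHA rho B IHB|A IHA B IHB|A IHA B IHB|//|t Rs] /=.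
- by rewrite IHA IHB -imfset_comp.
- by rewrite IHA IHB.
- by rewrite IHA IHB.
- by rewrite map_comp.
Qed.

Lemma map_rrepl Rs' Rs :
  uniq Rs' -> size Rs = size Rs' -> map (rrepl Rs' Rs) Rs' = Rs.
Proof.
move=> uniqRs' eq_sz; apply: (@eq_from_nth _ 0); rewrite size_map // => i lti.
rewrite (nth_map 0) // /rrepl mem_nth // index_uniq //.
by apply: set_nth_default; rewrite eq_sz.
Qed.

Lemma rrepl_in Rs' Rs X :
  X \in Rs' -> size Rs = size Rs' -> rrepl Rs' Rs X \in Rs.
Proof.
by move=> inX eq_sz; rewrite /rrepl inX mem_nth // eq_sz index_mem.
Qed.

(** As the entries of [Rs] are distinct, equal images come from equal positions in [Rs']. This makes
    function unfolding an injective renaming. *)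
Lemma rrepl_inj Rs' Rs :
  uniq Rs -> size Rs = size Rs' -> {in Rs' &, injective (rrepl Rs' Rs)}.
Proof.
move=> uniqRs eq_sz X Y inX inY; rewrite /rrepl inX inY.
rewrite (set_nth_default X Y) ?eq_sz ?index_mem //.
move/eqP; rewrite nth_uniq ?eq_sz ?index_mem // => /eqP.
exact: index_inj.
Qed.

(** [rrepl] acts by position, so once the parameters cover [T] a later renaming passes to the actual
    roles. The types concluded by [T_Def] and [T_Eq] thus commute with renaming. *)
Lemma ty_map_rrepl phi Rs' Rs T :
  ty_roles T `<=` rset Rs' -> size Rs = size Rs' ->
  ty_map phi (ty_map (rrepl Rs' Rs) T) = ty_map (rrepl Rs' (map phi Rs)) T.
Proof.
move=> /fsubsetP sub_T eq_sz; rewrite ty_map_comp; apply: eq_in_ty_map => X.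
move=> /sub_T; rewrite in_rset /= /rrepl => inX.
by rewrite inX (nth_map X) // eq_sz index_mem.
Qed.

Lemma ty_roles_rrepl Rs' Rs T :
  ty_roles T `<=` rset Rs' -> size Rs = size Rs' ->
  ty_roles (ty_map (rrepl Rs' Rs) T) `<=` rset Rs.
Proof.
move=> /fsubsetP sub_T eq_sz; rewrite ty_roles_map.
apply/fsubsetP => _ /imfsetP[X /= /sub_T inX ->].
by move: inX; rewrite !in_rset => inX; apply: rrepl_in.
Qed.

(** Well-formedness gives an equality, not a mere inclusion, so [T_Eq] leaves the roles of a type
    unchanged. *)
Lemma ty_roles_unfold Sigma t Rs Rs' T :
  wf_tdefs Sigma -> Sigma t = Some (Rs, T) -> size Rs = size Rs' ->
  ty_roles (ty_map (rrepl Rs Rs') T) = rset Rs'.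
Proof.
move=> [wfS _] /wfS[uniqRs eqT] eq_sz.
by rewrite ty_roles_map eqT -rset_map map_rrepl.
Qed.

Lemma ty_roles_com S R T :
  ty_roles T = [fset S] -> ty_roles (ty_map (rrepl [:: S] [:: R]) T) = [fset R].
Proof.
by move=> eqT; rewrite ty_roles_map eqT imfset_fset1 /rrepl !inE eqxx /= eqxx.
Qed.

(** * Role sets of typing judgements *)

Lemma typing_roles Theta Sigma Gamma M T :
  wf_tdefs Sigma -> typing Theta Sigma Gamma M T -> ty_roles T `<=` Theta.
Proof.
move=> wfS tyM; elim: tyM wfS => {Theta Sigma Gamma M T} /=.
- by [].
- move=> Th Sg Gamma N M T rho T' _ IHN _ _ /IHN.
  by rewrite !fsubUset => /andP[/andP[_ ->]].
- by move=> Th Sg Gamma T M rho T' _ _ sub_Th _; rewrite fsetUC fsetUA.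
- by move=> Th Sg Gamma N M M' T1 T2 T _ _ _ IHM _ _ /IHM.
- by move=> Th Sg Gamma S R l M T _ IHM _ /IHM.
- move=> Th Sg Gamma f Rs Rs' T _ subT subRs eq_sz _ _.
  exact: fsubset_trans (ty_roles_rrepl subT eq_sz) subRs.
- by move=> Th _ _ R inR _; rewrite fsub1set.
- by move=> Th _ _ S R T eqT subSR _; rewrite (ty_roles_com _ eqT) eqT fsetU0.
- by move=> Th Sg Gamma V V' T T' _ IHV _ IHV' wfS; rewrite fsubUset IHV ?IHV'.
- move=> Th _ _ T T' subT _.
  by rewrite fsetU0 fsubUset subT (fsubset_trans (fsubsetUl _ _) subT).
- move=> Th _ _ T T' subT _.
  by rewrite fsetU0 fsubUset subT (fsubset_trans (fsubsetUr _ _) subT).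
- by [].
- by [].
- move=> Th Sg Gamma M t Rs Rs' T _ _ def_t subRs eq_sz _ wfS.
  by rewrite (ty_roles_unfold wfS def_t).
Qed.

Lemma typing_weaken Theta Theta1 Sigma Gamma M T :
  typing Theta Sigma Gamma M T -> Theta `<=` Theta1 ->
  typing Theta1 Sigma Gamma M T.
Proof.
move=> tyM; elim: tyM Theta1 => {Theta Sigma Gamma M T}.
- by move=> *; apply: T_Var => //; apply: fsubset_trans; eassumption.
- by move=> *; apply: T_App; auto.
(* The body is typed in the abstraction's own role set, so only the inclusion has to be extended. *)
- by move=> *; apply: T_Abs => //; apply: fsubset_trans; eassumption.
- by move=> *; apply: T_Case; auto.
- by move=> *; apply: T_Sel; auto; apply: fsubset_trans; eassumption.
- by move=> *; apply: T_Def => //; apply: fsubset_trans; eassumption.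
- by move=> Th Sg Gamma R inR Th1 /fsubsetP subTh; apply: T_Unit; apply: subTh.
- by move=> *; apply: T_Com => //; apply: fsubset_trans; eassumption.
- by move=> *; apply: T_Pair; auto.
- by move=> *; apply: T_Proj1; apply: fsubset_trans; eassumption.
- by move=> *; apply: T_Proj2; apply: fsubset_trans; eassumption.
- by move=> *; apply: T_Inl; auto; apply: fsubset_trans; eassumption.
- by move=> *; apply: T_Inr; auto; apply: fsubset_trans; eassumption.
- move=> *; apply: T_Eq; eauto; apply: fsubset_trans; eassumption.
Qed.

(* A variable may occur under abstractions whose role set is smaller than the
   one in which a value substituted for it was typed. *)
Lemma typing_value_roles Theta Sigma Gamma V T :
  wf_tdefs Sigma -> typing Theta Sigma Gamma (Val V) T ->
  typing (ty_roles T) Sigma Gamma (Val V) T.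
Proof.
move=> wfS; move eqM: (Val V) => M tyM.
elim: tyM wfS V eqM => {Theta Sigma Gamma M T} //.
- by move=> *; apply: T_Var.
(* The role set of the body consists exactly of the roles of the arrow type. *)
- move=> Th Sg Gamma T M rho T' Th' tyM _ _ _ _ _; apply: T_Abs => //=.
  by rewrite -fsetUA fsetUC.
- by move=> *; apply: T_Unit; rewrite inE.
- move=> Th Sg Gamma S R T eqT _ _ _ _; apply: T_Com => //=.
  by rewrite (ty_roles_com _ eqT) eqT fsetU0.
- move=> Th Sg Gamma V V' T T' _ IHV _ IHV' wfS _ _; apply: T_Pair.
    exact: typing_weaken (IHV wfS _ erefl) (fsubsetUl _ _).
  exact: typing_weaken (IHV' wfS _ erefl) (fsubsetUr _ _).
- by move=> Th Sg Gamma T T' _ _ _ _; apply: T_Proj1; rewrite /= fsetU0 fsubsetUl.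
- by move=> Th Sg Gamma T T' _ _ _ _; apply: T_Proj2; rewrite /= fsetU0 fsubsetUl.
- move=> Th Sg Gamma V T T' _ IHV _ wfS _ _; apply: T_Inl => //.
  exact: typing_weaken (IHV wfS _ erefl) (fsubsetUl _ _).
- move=> Th Sg Gamma V T T' _ IHV _ wfS _ _; apply: T_Inr => //.
  exact: typing_weaken (IHV wfS _ erefl) (fsubsetUr _ _).
- move=> Th Sg Gamma M t Rs Rs' T _ IHM def_t _ eq_sz uniqRs' wfS V eqM.
  have := IHM wfS V eqM; rewrite (ty_roles_unfold wfS def_t) //= => tyM.
  exact: (T_Eq tyM def_t).
Qed.

(** * Renaming and substitution of variables *)

Lemma typing_ren Theta Sigma Gamma Delta xi M T :
  typing Theta Sigma Gamma M T -> fdecls Delta = fdecls Gamma ->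
  (forall n A, onth (vdecls Gamma) n = Some A ->
     onth (vdecls Delta) (xi n) = Some A) ->
  typing Theta Sigma Delta (ren xi M) T.
Proof.
move=> tyM; elim: tyM Delta xi => {Theta Sigma Gamma M T} /=.
- by move=> Th Sg Gamma n T onth_n sub_T Delta xi _ xiP; apply: T_Var; auto.
- by move=> *; apply: T_App; eauto.
- move=> Th Sg Gamma T M rho T' _ IHM sub_Th Delta xi eq_f xiP.
  by apply: T_Abs => //; apply: IHM => //= -[|n] //=; apply: xiP.
- move=> Th Sg Gamma N M M' T1 T2 T _ IHN _ IHM _ IHM' Delta xi eq_f xiP.
  apply: T_Case; first exact: IHN.
    by apply: IHM => //= -[|n] //=; apply: xiP.
  by apply: IHM' => //= -[|n] //=; apply: xiP.
- by move=> *; apply: T_Sel; auto.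
- by move=> ? ? ? ? ? ? ? ? ? ? ? ? ? ? eq_f _; apply: T_Def => //; rewrite eq_f.
- by move=> *; apply: T_Unit.
- by move=> *; apply: T_Com.
- by move=> *; apply: T_Pair; auto.
- by move=> *; apply: T_Proj1.
- by move=> *; apply: T_Proj2.
- by move=> *; apply: T_Inl; auto.
- by move=> *; apply: T_Inr; auto.
- by move=> *; apply: T_Eq; eauto.
Qed.

Lemma typing_shift Theta Sigma Gamma A M T :
  typing Theta Sigma Gamma M T ->
  typing Theta Sigma (bindv Gamma A) (shift M) T.
Proof. by move=> tyM; apply: typing_ren tyM _ _. Qed.

(** Typing each substituted value in the roles of its own type survives the change of role set under
    an abstraction; at an occurrence, [T_Var] supplies the inclusion needed to weaken. *)
Lemma typing_sub Theta Sigma Gamma Delta sigma M T :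
  typing Theta Sigma Gamma M T -> fdecls Delta = fdecls Gamma ->
  (forall n A, onth (vdecls Gamma) n = Some A ->
     typing (ty_roles A) Sigma Delta (Val (sigma n)) A) ->
  typing Theta Sigma Delta (sub sigma M) T.
Proof.
have up_typing Sg G G' s A :
    (forall n B, onth (vdecls G) n = Some B ->
       typing (ty_roles B) Sg G' (Val (s n)) B) ->
    forall n B, onth (vdecls (bindv G A)) n = Some B ->
       typing (ty_roles B) Sg (bindv G' A) (Val (up_sub s n)) B.
  move=> sP [|n] B /=; first by move=> [<-]; apply: T_Var.
  by move=> /sP; apply: typing_shift.
move=> tyM; elim: tyM Delta sigma => {Theta Sigma Gamma M T} /=.
- move=> Th Sg Gamma n T onth_n sub_T Delta s _ sP.
  by apply: typing_weaken sub_T; apply: sP.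
- by move=> *; apply: T_App; eauto.
- move=> Th Sg Gamma T M rho T' _ IHM sub_Th Delta s eq_f sP.
  by apply: T_Abs => //; apply: IHM => //=; apply: up_typing.
- move=> Th Sg Gamma N M M' T1 T2 T _ IHN _ IHM _ IHM' Delta s eq_f sP.
  apply: T_Case; first exact: IHN.
    by apply: IHM => //=; apply: up_typing.
  by apply: IHM' => //=; apply: up_typing.
- by move=> *; apply: T_Sel; auto.
- by move=> ? ? ? ? ? ? ? ? ? ? ? ? ? ? eq_f _; apply: T_Def => //; rewrite eq_f.
- by move=> *; apply: T_Unit.
- by move=> *; apply: T_Com.
- by move=> *; apply: T_Pair; auto.
- by move=> *; apply: T_Proj1.
- by move=> *; apply: T_Proj2.
- by move=> *; apply: T_Inl; auto.
- by move=> *; apply: T_Inr; auto.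
- by move=> *; apply: T_Eq; eauto.
Qed.

(** The two role sets can be unrelated, since the value is first restricted to the roles of [A]. *)
Lemma typing_sub1 Theta Theta1 Sigma Gamma A M V T :
  wf_tdefs Sigma -> typing Theta Sigma (bindv Gamma A) M T ->
  typing Theta1 Sigma Gamma (Val V) A ->
  typing Theta Sigma Gamma (sub1 V M) T.
Proof.
move=> wfS tyM tyV; apply: typing_sub tyM _ _ => //= -[|n] B /= onth_n.
  by case: onth_n => <-; apply: typing_value_roles tyV.
by apply: T_Var.
Qed.

(** * Free variables and renaming of roles *)

Lemma mem_unbind n A : (n \in unbind A) = (n.+1 \in A).
Proof.
apply/imfsetP/idP => /= [[[|m]]|inA]; rewrite ?inE ?eqxx //=.
  by move=> inA ->.
by exists n.+1; rewrite // !inE.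
Qed.

(** A derivation looks up free variables only, so the variable context of a closed term can be
    emptied or replaced. *)
Lemma typing_fv Theta Sigma Gamma Delta M T :
  typing Theta Sigma Gamma M T -> fdecls Delta = fdecls Gamma ->
  (forall n A, n \in fv M -> onth (vdecls Gamma) n = Some A ->
     onth (vdecls Delta) n = Some A) ->
  typing Theta Sigma Delta M T.
Proof.
move=> tyM; elim: tyM Delta => {Theta Sigma Gamma M T} /=.
- move=> Th Sg Gamma n T onth_n sub_T Delta _ eqv; apply: T_Var => //.
  by apply: eqv => //; rewrite inE.
- move=> Th Sg Gamma N M T rho T' _ IHN _ IHM Delta eq_f eqv.
  by apply: T_App; [apply: IHN|apply: IHM] => // n A inn; apply: eqv;
    rewrite inE inn ?orbT.
- move=> Th Sg Gamma T M rho T' _ IHM sub_Th Delta eq_f eqv.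
  apply: T_Abs => //; apply: IHM => //= -[|n] //= A inn.
  by apply: eqv; rewrite mem_unbind.
- move=> Th Sg Gamma N M M' T1 T2 T _ IHN _ IHM _ IHM' Delta eq_f eqv.
  apply: T_Case.
  + by apply: IHN => // n A inn; apply: eqv; rewrite !inE inn.
  + apply: IHM => //= -[|n] //= A inn.
    by apply: eqv; rewrite !(inE, mem_unbind) inn orbT.
  + apply: IHM' => //= -[|n] //= A inn.
    by apply: eqv; rewrite !(inE, mem_unbind) inn orbT.
- by move=> *; apply: T_Sel; auto.
- by move=> ? ? ? ? ? ? ? ? ? ? ? ? ? eq_f _; apply: T_Def => //; rewrite eq_f.
- by move=> *; apply: T_Unit.
- by move=> *; apply: T_Com.
- move=> Th Sg Gamma V V' T T' _ IHV _ IHV' Delta eq_f eqv.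
  by apply: T_Pair; [apply: IHV|apply: IHV'] => // n A inn; apply: eqv;
    rewrite inE inn ?orbT.
- by move=> *; apply: T_Proj1.
- by move=> *; apply: T_Proj2.
- by move=> *; apply: T_Inl; auto.
- by move=> *; apply: T_Inr; auto.
- by move=> *; apply: T_Eq; eauto.
Qed.

Lemma imfsetS (phi : role -> role) (A B : {fset role}) :
  A `<=` B -> [fset phi X | X in A] `<=` [fset phi X | X in B].
Proof. by move/fsubsetP=> subAB; apply: subset_imfset. Qed.

(* Injectivity keeps the role arguments of functions and type variables
   distinct. *)
Lemma typing_rmap phi Theta Sigma Gamma M T :
  wf_tdefs Sigma -> typing Theta Sigma Gamma M T ->
  {in Theta &, injective phi} ->
  typing [fset phi X | X in Theta] Sigma
    (Ctx (fdecls Gamma) (map (ty_map phi) (vdecls Gamma)))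
    (rmap phi M) (ty_map phi T).
Proof.
have uniq_map Rs (Th : {fset role}) : rset Rs `<=` Th ->
    {in Th &, injective phi} -> uniq Rs -> uniq (map phi Rs).
  move=> /fsubsetP subRs injphi; rewrite map_inj_in_uniq // => X Y inX inY.
  by apply: injphi; apply: subRs; rewrite in_rset.
have sub2 S R (Th : {fset role}) : [fset S; R] `<=` Th ->
    [fset phi S; phi R] `<=` [fset phi X | X in Th].
  by move/(imfsetS phi); rewrite imfsetU !imfset_fset1.
move=> wfS tyM; elim: tyM wfS => {Theta Sigma Gamma M T} /=.
- move=> Th Sg Gamma n T onth_n subT wfS injphi; apply: T_Var.
    by rewrite /= onth_map onth_n.
  by rewrite ty_roles_map imfsetS.
- by move=> *; apply: T_App; eauto.
- move=> Th Sg Gamma T M rho T'; set Th' := _ `|` ty_roles T'.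
  move=> _ IHM sub_Th wfS injphi.
  have inj' : {in Th' &, injective phi}.
    by move=> X Y inX inY; apply: injphi; apply: (fsubsetP sub_Th).
  (* Images commute with unions, so the role set that [T_Abs] reads off the renamed types is the one
     in the induction hypothesis. *)
  have eqTh : [fset phi X | X in rho] `|` ty_roles (ty_map phi T)
      `|` ty_roles (ty_map phi T') = [fset phi X | X in Th'].
    by rewrite !ty_roles_map -!imfsetU.
  apply: T_Abs; rewrite eqTh; first exact: IHM.
  exact: imfsetS.
- by move=> *; apply: T_Case; eauto.
- by move=> *; apply: T_Sel; auto.
- move=> Th Sg Gamma f Rs Rs' T def_f sub_T subRs eq_sz uniqRs wfS injphi.
  (* The declaration of [f] stays fixed; the renaming moves into the actual roles. *)
  rewrite (ty_map_rrepl _ sub_T eq_sz); apply: T_Def => //.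
  + by rewrite rset_map imfsetS.
  + by rewrite size_map.
  + exact: uniq_map injphi _.
- by move=> Th Sg Gamma R inR _ _; apply/T_Unit/imfsetP; exists R.
- move=> Th Sg Gamma S R T eqT subSR wfS injphi.
  (* Only [S] occurs in [T], and both composites send it to [phi R]. *)
  have -> : ty_map phi (ty_map (rrepl [:: S] [:: R]) T) =
      ty_map (rrepl [:: phi S] [:: phi R]) (ty_map phi T).
    rewrite !ty_map_comp; apply: eq_in_ty_map => X; rewrite eqT inE => /eqP->.
    by rewrite /= /rrepl !inE !eqxx /= !eqxx.
  rewrite imfset0; apply: T_Com (sub2 _ _ _ subSR).
  by rewrite ty_roles_map eqT imfset_fset1.
- by move=> *; apply: T_Pair; auto.
- move=> Th Sg Gamma T T' subT _ _; rewrite imfset0; apply: T_Proj1.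
  by rewrite /= !ty_roles_map -imfsetU imfsetS.
- move=> Th Sg Gamma T T' subT _ _; rewrite imfset0; apply: T_Proj2.
  by rewrite /= !ty_roles_map -imfsetU imfsetS.
- move=> Th Sg Gamma V T T' _ IHV subT wfS injphi; apply: T_Inl; first exact: IHV.
  by rewrite /= !ty_roles_map -imfsetU imfsetS.
- move=> Th Sg Gamma V T T' _ IHV subT wfS injphi; apply: T_Inr; first exact: IHV.
  by rewrite /= !ty_roles_map -imfsetU imfsetS.
- move=> Th Sg Gamma M t Rs Rs' T _ IHM def_t subRs eq_sz uniqRs' wfS injphi.
  have [wf1 _] := wfS; have [_ eqT] := wf1 _ _ _ def_t.
  rewrite ty_map_rrepl ?eqT //; apply: T_Eq (IHM wfS injphi) def_t _ _ _.
  + by rewrite rset_map imfsetS.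
  + by rewrite size_map.
  + exact: uniq_map injphi _.
Qed.

(** * Delayed unfolding of type variables and inversion of typing *)

(** A chain of [T_Eq] steps, separated from the term: such steps change the type alone, so the chain
    can be replayed on any term of type [T1]. *)
Inductive unfolds (Theta : {fset role}) (Sigma : tdefs) (T1 : ty) :
  ty -> Prop :=
| unfolds_refl : unfolds Theta Sigma T1 T1
| unfolds_step t Rs Rs' T :
    unfolds Theta Sigma T1 (TyVar t Rs') ->
    Sigma t = Some (Rs, T) ->
    rset Rs' `<=` Theta -> size Rs = size Rs' -> uniq Rs' ->
    unfolds Theta Sigma T1 (ty_map (rrepl Rs Rs') T).

Lemma unfolds_typing Theta Theta1 Sigma Gamma M T1 T :
  unfolds Theta Sigma T1 T -> Theta `<=` Theta1 ->
  typing Theta1 Sigma Gamma M T1 -> typing Theta1 Sigma Gamma M T.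
Proof.
move=> unf subTh tyM; elim: unf => // t Rs Rs' T' _ tyM' def_t subRs eq_sz uRs'.
exact: T_Eq tyM' def_t (fsubset_trans subRs subTh) eq_sz uRs'.
Qed.

Definition is_tyvar T := if T is TyVar _ _ then true else false.

Lemma unfolds_eq Theta Sigma T1 T :
  unfolds Theta Sigma T1 T -> ~~ is_tyvar T1 -> T = T1.
(* For a nonempty chain the induction hypothesis would make [T1] the type variable [TyVar t Rs'], a
   contradiction. *)
Proof. by elim=> // t Rs Rs' T' _ IH _ _ _ _ /[dup] /IH <-. Qed.

(* Inversion of the only rule other than [T_Eq] that applies to [M]; variables
   and units, which need none, are left unconstrained. *)
Definition generates Theta Sigma Gamma (M : chor) (T : ty) : Prop :=
  match M with
  | App N M =>
      exists A rho, typing Theta Sigma Gamma N (TyArr A rho T) /\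
                    typing Theta Sigma Gamma M A
  | Case N M1 M2 =>
      exists T1 T2,
        [/\ typing Theta Sigma Gamma N (TySum T1 T2),
            typing Theta Sigma (bindv Gamma T1) M1 T &
            typing Theta Sigma (bindv Gamma T2) M2 T]
  | Sel R1 R2 _ M => typing Theta Sigma Gamma M T /\ [fset R1; R2] `<=` Theta
  | Fun f Rs =>
      exists Rs' T',
        [/\ fdecls Gamma f = Some (Rs', T'), rset Rs `<=` Theta,
            size Rs = size Rs', uniq Rs & T = ty_map (rrepl Rs' Rs) T']
  | Val (Lam A M) =>
      exists rho B, let Theta' := rho `|` ty_roles A `|` ty_roles B in
        [/\ T = TyArr A rho B, typing Theta' Sigma (bindv Gamma A) M B &
            Theta' `<=` Theta]
  | Val (Inl V) =>
      exists T1 T2, T = TySum T1 T2 /\ typing Theta Sigma Gamma (Val V) T1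
  | Val (Inr V) =>
      exists T1 T2, T = TySum T1 T2 /\ typing Theta Sigma Gamma (Val V) T2
  | Val (Pair V V') =>
      exists T1 T2,
        [/\ T = TyProd T1 T2, typing Theta Sigma Gamma (Val V) T1 &
            typing Theta Sigma Gamma (Val V') T2]
  | Val Fst => exists T1 T2, T = TyArr (TyProd T1 T2) fset0 T1
  | Val Snd => exists T1 T2, T = TyArr (TyProd T1 T2) fset0 T2
  | Val (Com R1 R2) =>
      exists A, [/\ T = TyArr A fset0 (ty_map (rrepl [:: R1] [:: R2]) A),
                    ty_roles A = [fset R1] & [fset R1; R2] `<=` Theta]
  | _ => True
  end.

(** A final [T_Eq] extends the chain; every other rule starts an empty one. *)
Lemma typing_inv Theta Sigma Gamma M T :
  typing Theta Sigma Gamma M T ->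
  exists2 T1, generates Theta Sigma Gamma M T1 & unfolds Theta Sigma T1 T.
Proof.
elim=> {Theta Sigma Gamma M T}; try by [move=> *; eexists;
  last exact: unfolds_refl; rewrite //=; do ?eexists; eauto].
  move=> Th Sg Gamma f Rs Rs' T decl_f _ subRs eq_sz uniqRs.
  by eexists; last exact: unfolds_refl; exists Rs', T.
move=> Th Sg Gamma M t Rs Rs' T _ [T1 genM unfT] def_t subRs eq_sz uniqRs'.
by exists T1 => //; apply: unfolds_step unfT _ _ _ _.
Qed.

Definition intro_form V :=
  match V with Var _ | Unit _ => false | _ => true end.

(* Introduction forms only have types that [T_Eq] cannot unfold further. *)
Lemma typing_value_inv Theta Sigma Gamma V T :
  typing Theta Sigma Gamma (Val V) T -> intro_form V ->
  generates Theta Sigma Gamma (Val V) T.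
Proof.
move=> /typing_inv[T1 genV /unfolds_eq unfT] introV.
suff /unfT-> : ~~ is_tyvar T1 by [].
case: V introV genV {unfT} => //=.
- by move=> A M _ [rho [B [-> _ _]]].
- by move=> V _ [A [B [-> _]]].
- by move=> V _ [A [B [-> _]]].
- by move=> _ [A [B ->]].
- by move=> _ [A [B ->]].
- by move=> V V' _ [A [B [-> _ _]]].
- by move=> S R _ [A [-> _ _]].
Qed.

(** * Rewriting *)

(** [Lam] does not record the annotation of its arrow type, so a redex is typed like a let-binding.
    Rewriting can then move a term into the body. *)
Lemma typing_redexP Theta Sigma Gamma A M N T :
  wf_tdefs Sigma ->
  typing Theta Sigma Gamma (App (Val (Lam A M)) N) T <->
  typing Theta Sigma (bindv Gamma A) M T /\ typing Theta Sigma Gamma N A.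
Proof.
move=> wfS; split=> [/typing_inv[T1 /= [A' [rho [tyL tyN]]] unfT]|[tyM tyN]].
  have [rho' [B [[eqA _ eqB] tyM subTh]]] := typing_value_inv tyL isT.
  split; last by rewrite -eqA.
  apply: unfolds_typing unfT (fsubset_refl _) _; rewrite eqB.
  exact: typing_weaken tyM subTh.
(* The roles of [A] and [T] lie in [Theta], so under the annotation [Theta] the body keeps the role
   set [Theta]. *)
have eqTh : Theta `|` ty_roles A `|` ty_roles T = Theta.
  by rewrite -fsetUA; apply/fsetUidPl;
    rewrite fsubUset (typing_roles wfS tyN) (typing_roles wfS tyM).
by apply: (T_App _ tyN); apply: (@T_Abs _ _ _ _ _ Theta); rewrite eqTh.
Qed.

Lemma rew_typing Theta Sigma Gamma M M' T :
  wf_tdefs Sigma -> rew M M' ->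
  typing Theta Sigma Gamma M T -> typing Theta Sigma Gamma M' T.
Proof.
move=> wfS rewM /typing_inv[T1 genM unfT].
apply: unfolds_typing unfT (fsubset_refl _) _.
case: rewM genM => {M M' T} /=.
- move=> A M N M' [B [rho [/(typing_redexP _ _ _ _ _ _ wfS)[tyM tyN] tyM']]].
  apply/(typing_redexP _ _ _ _ _ _ wfS); split=> //.
  exact: T_App tyM (typing_shift _ tyM').
- move=> A M N M' _ [B [rho [tyM' /(typing_redexP _ _ _ _ _ _ wfS)[tyM tyN]]]].
  apply/(typing_redexP _ _ _ _ _ _ wfS); split=> //.
  exact: T_App (typing_shift _ tyM') tyM.
(* The type of the case may come from [T_Eq] steps; their chain [unfC] is replayed on each branch
   before the application is formed. *)
- move=> N M1 M2 M [B [rho [/typing_inv[C /= [A1 [A2 [tyN ty1 ty2]]] unfC] tyM]]].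
  by apply: T_Case tyN _ _; apply: (T_App _ (typing_shift _ tyM));
    apply: unfolds_typing unfC (fsubset_refl _) _.
- move=> N M1 M2 M _ [B [rho [tyM /typing_inv[C /= [A1 [A2 [tyN ty1 ty2]]] unfC]]]].
  by apply: T_Case tyN _ _; apply: (T_App (typing_shift _ tyM));
    apply: unfolds_typing unfC (fsubset_refl _) _.
- move=> S R l N M [B [rho [/typing_inv[C /= [tyN subSR] unfC] tyM]]].
  apply: T_Sel subSR; apply: (T_App _ tyM).
  exact: unfolds_typing unfC (fsubset_refl _) _.
- move=> S R l N M _ [B [rho [tyM /typing_inv[C /= [tyN subSR] unfC]]]].
  apply: T_Sel subSR; apply: (T_App tyM).
  exact: unfolds_typing unfC (fsubset_refl _) _.
Qed.

Lemma rews_typing Theta Sigma Gamma M M' T :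
  wf_tdefs Sigma -> clos_refl_trans chor rew M M' ->
  typing Theta Sigma Gamma M T -> typing Theta Sigma Gamma M' T.
Proof.
move=> wfS; elim=> {M M'} [M M' rewM|//|M1 M2 M3 _ IH1 _ IH2 tyM1].
  exact: rew_typing.
by apply: IH2; apply: IH1.
Qed.

(** * Communication, function unfolding and transitions *)

(** With the variable context emptied no variable type has to be renamed, and the result holds in
    any [Delta] with the same function declarations. *)
Lemma closed_typing_rmap phi Theta Sigma Gamma Delta M T :
  wf_tdefs Sigma -> is_closed M -> typing Theta Sigma Gamma M T ->
  {in Theta &, injective phi} -> fdecls Delta = fdecls Gamma ->
  typing [fset phi X | X in Theta] Sigma Delta (rmap phi M) (ty_map phi T).
Proof.
move=> wfS closM tyM inj eq_f.
have tyM0 : typing Theta Sigma (Ctx (fdecls Gamma) [::]) M T.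
  by apply: typing_fv tyM _ _ => // n A; rewrite closM.
by apply: typing_fv (typing_rmap wfS tyM0 inj) eq_f _ => -[].
Qed.

(** The value is typed in [[fset S]], on which every map is injective; the image [[fset R]] lies in
    [Theta]. *)
Lemma typing_com Theta Sigma Gamma S R V T :
  wf_tdefs Sigma -> is_closed (Val V) -> ty_roles T = [fset S] ->
  R \in Theta -> typing Theta Sigma Gamma (Val V) T ->
  typing Theta Sigma Gamma (Val (val_rmap (rrepl [:: S] [:: R]) V))
    (ty_map (rrepl [:: S] [:: R]) T).
Proof.
move=> wfS closV eqT inR tyV.
have := typing_value_roles wfS tyV; rewrite eqT => tyVS.
have inj : {in [fset S] &, injective (rrepl [:: S] [:: R])}.
  by move=> X Y; rewrite !inE => /eqP-> /eqP->.
apply: (typing_weaken (closed_typing_rmap wfS closV tyVS inj erefl)).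
by rewrite -eqT -ty_roles_map (ty_roles_com _ eqT) fsub1set.
Qed.

(** The body is typed in exactly its parameters, which the replacement maps bijectively onto the
    actual roles; the call puts these in [Theta1]. *)
Lemma typing_def Theta Theta1 Sigma Gamma Delta D f Rs Rs' M T :
  wf_tdefs Sigma -> closed_defs D -> typed_defs Theta Sigma Gamma D ->
  fdecls Delta = fdecls Gamma -> D f Rs' = Some M ->
  typing Theta1 Sigma Delta (Fun f Rs) T ->
  typing Theta1 Sigma Delta (rmap (rrepl Rs' Rs) M) T.
Proof.
move=> wfS closD tyD eq_f def_f /typing_inv[T1 /= [Rs1 [T2 []]]].
have [T' [decl_f tyM uniqRs' _]] := tyD _ _ _ def_f.
(* [f] has a single declaration, so call and body agree on parameters and type. *)
rewrite eq_f decl_f => -[<- <-] subRs eq_sz uniqRs -> unfT.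
apply: unfolds_typing unfT (fsubset_refl _) _.
have inj : {in rset Rs' &, injective (rrepl Rs' Rs)}.
  by move=> X Y; rewrite !in_rset; apply: rrepl_inj.
apply: (typing_weaken (closed_typing_rmap wfS (closD _ _ _ def_f) tyM inj eq_f)).
by rewrite -rset_map map_rrepl.
Qed.

(* The context varies, because steps occur under binders; only its function
   declarations have to agree with those that type the definitions. *)
Lemma step_typing Theta Theta1 Sigma Gamma Delta D M ell RR M' T :
  wf_tdefs Sigma -> closed_defs D -> typed_defs Theta Sigma Gamma D ->
  step D M ell RR M' -> fdecls Delta = fdecls Gamma ->
  typing Theta1 Sigma Delta M T -> typing Theta1 Sigma Delta M' T.
Proof.
move=> wfS closD tyD stepM.
(* The role set varies too, since the body of an abstraction has its own. The cases run from [S_Str]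
   back to [S_AppAbs]. *)
elim: stepM Theta1 Delta T => {M ell RR M'}; last first.
- move=> M N M' RR rewM _ IHN Th Delta T eq_f tyM.
  exact: IHN eq_f (rews_typing wfS rewM tyM).
- move=> S R l M M' ell RR _ IHM _ Th Delta T eq_f.
  move=> /typing_inv[T1 /= [tyM subSR] unfT].
  apply: unfolds_typing unfT (fsubset_refl _) _.
  by apply: T_Sel subSR; apply: IHM.
- move=> S R l M Th Delta T _ /typing_inv[T1 /= [tyM _] unfT].
  exact: unfolds_typing unfT (fsubset_refl _) _.
- move=> S R V closV Th Delta T _ /typing_inv[T1 /= [A [rho [tyC tyV]]] unfT].
  apply: unfolds_typing unfT (fsubset_refl _) _.
  (* Inversion of [Com S R] shows that [S] is the only role of the argument type and that [R] is in
     [Th]. *)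
  have [B [[eqA _ ->] eqB /fsubsetP subSR]] := typing_value_inv tyC isT.
  apply: typing_com => //; last by rewrite -eqA.
  by apply: subSR; rewrite !inE eqxx orbT.
- move=> f Rs Rs' M def_f Th Delta T eq_f.
  exact: typing_def wfS closD tyD eq_f def_f.
- move=> V V' Th Delta T _ /typing_inv[T1 /= [A [rho [tyC tyP]]] unfT].
  apply: unfolds_typing unfT (fsubset_refl _) _.
  have [B1 [B2 [eqA _ ->]]] := typing_value_inv tyC isT.
  (* The domain of the projection and the type of the pair are the same product, so the components
     agree. *)
  by have [C1 [C2 []]] := typing_value_inv tyP isT; rewrite eqA => -[_ ->].
- move=> V V' Th Delta T _ /typing_inv[T1 /= [A [rho [tyC tyP]]] unfT].
  apply: unfolds_typing unfT (fsubset_refl _) _.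
  have [B1 [B2 [eqA _ ->]]] := typing_value_inv tyC isT.
  by have [C1 [C2 []]] := typing_value_inv tyP isT; rewrite eqA => -[-> _].
- move=> V M M' Th Delta T _ /typing_inv[T1 /= [A [B [tyV tyM tyM']]] unfT].
  apply: unfolds_typing unfT (fsubset_refl _) _.
  have [A1 [B1 [[_ eqB] tyV1]]] := typing_value_inv tyV isT.
  by apply: typing_sub1 wfS tyM' _; rewrite eqB; exact: tyV1.
- move=> V M M' Th Delta T _ /typing_inv[T1 /= [A [B [tyV tyM tyM']]] unfT].
  apply: unfolds_typing unfT (fsubset_refl _) _.
  have [A1 [B1 [[eqA _] tyV1]]] := typing_value_inv tyV isT.
  by apply: typing_sub1 wfS tyM _; rewrite eqA; exact: tyV1.
- move=> N M1 M1' M2 M2' ell RR _ IH1 _ IH2 _ Th Delta T eq_f.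
  move=> /typing_inv[T1 /= [A [B [tyN tyM tyM']]] unfT].
  apply: unfolds_typing unfT (fsubset_refl _) _.
  by apply: T_Case tyN _ _; [apply: IH1|apply: IH2].
- move=> N N' M M' RR _ IHN Th Delta T eq_f.
  move=> /typing_inv[T1 /= [A [B [tyN tyM tyM']]] unfT].
  apply: unfolds_typing unfT (fsubset_refl _) _.
  by apply: T_Case tyM tyM'; apply: IHN.
- move=> M N N' RR _ IHN _ Th Delta T eq_f.
  move=> /typing_inv[T1 /= [A [rho [tyM tyN]]] unfT].
  apply: unfolds_typing unfT (fsubset_refl _) _.
  by apply: T_App tyM _; apply: IHN.
- move=> V N N' RR _ IHN Th Delta T eq_f.
  move=> /typing_inv[T1 /= [A [rho [tyM tyN]]] unfT].
  apply: unfolds_typing unfT (fsubset_refl _) _.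
  by apply: T_App tyM _; apply: IHN.
- move=> M M' N ell RR _ IHM _ Th Delta T eq_f.
  move=> /typing_inv[T1 /= [A [rho [tyM tyN]]] unfT].
  apply: unfolds_typing unfT (fsubset_refl _) _.
  exact: T_App (IHM _ _ _ eq_f tyM) tyN.
- move=> A M M' ell RR _ IHM Th Delta T eq_f tyL.
  (* The induction hypothesis is used in the body's role set and extended context. *)
  have [rho [B [-> tyM subTh]]] := typing_value_inv tyL isT.
  by apply: T_Abs subTh; apply: IHM.
- move=> A M V Th Delta T _ /(typing_redexP _ _ _ _ _ _ wfS)[tyM tyV].
  exact: typing_sub1 wfS tyM tyV.
Qed.

Theorem theorem15 (M : chor) (D : defs) (T : ty)
    (Theta : {fset role}) (Sigma : tdefs) (Gamma : ctx) :
  is_closed M ->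
  closed_defs D ->
  wf_tdefs Sigma ->
  typing Theta Sigma Gamma M T ->
  typed_defs Theta Sigma Gamma D ->
  forall M' : chor, reduces D M M' -> typing Theta Sigma Gamma M' T.
Proof.
move=> _ closD wfS tyM tyD M' [RR stepM].
exact: (step_typing wfS closD tyD stepM erefl tyM).
Qed.
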